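(* Let $N\ge 1$ and let $z_1> z_2>\dots> z_N$ be the zeros of the classical Hermite polynomial $H_N$ (orthogonal with respect to the weight $e^{-x^2}$ on $\mathbb R$), and put ${\bf z}:=(z_1,\dots,z_N)$. For $k\ge0$ let $(X_{t,k})_{t\ge0}$ be the Bessel process of type $A_{N-1}$ with multiplicity $k$ on $C_N^A$, started in $0\in C_N^A$. Define the matrix $S=(s_{i,j})_{i,j=1,\dots,N}$ by $$s_{i,i}:=1+\sum_{l\ne i}(z_i-z_l)^{-2},\qquad s_{i,j}:=-(z_i-z_j)^{-2}\quad (i\ne j).$$ Then $S$ is invertible, and for every $t>0$, with $\Sigma:=S^{-1}$, $$X_{t,k}-\sqrt{2kt}\,{\bf z}\ \longrightarrow\ N(0,t\Sigma)\qquad\text{in distribution as }k\to\infty,$$ where $N(0,t\Sigma)$ is the centered $N$-dimensional normal distribution with covariance matrix $t\Sigma$ (equivalently, $X_{t,k}/\sqrt t-\sqrt{2k}\,{\bf z}\to N(0,\Sigma)$).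
   Context: $C_N^A:=\{x\in\mathbb R^N: x_1\ge x_2\ge\dots\ge x_N\}$. For $k\ge 0$, the Bessel process of type $A_{N-1}$ with multiplicity $k$ is the diffusion on $C_N^A$ with reflecting boundary whose generator is $Lf=\frac12\Delta f+k\sum_{i=1}^N\big(\sum_{j\ne i}\frac{1}{x_i-x_j}\big)\frac{\partial f}{\partial x_i}$ with domain the restrictions to $C_N^A$ of $C^2$ functions on $\mathbb R^N$ invariant under all permutations of coordinates. Started in $0$, $X_{t,k}$ has Lebesgue density on $C_N^A$ proportional to $e^{-\|y\|^2/(2t)}\prod_{i<j}(y_i-y_j)^{2k}$. *)

(* Defs.v *)
From HB Require Import structures.
From mathcomp Require Import all_boot all_order all_algebra.
From mathcomp Require Import all_classical all_reals all_analysis.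
Set Implicit Arguments. Unset Strict Implicit. Unset Printing Implicit Defensive.
Import Order.TTheory GRing.Theory Num.Theory.
Import numFieldNormedType.Exports.
Local Open Scope classical_set_scope.
Local Open Scope ring_scope.

(* Classical (physicists') Hermite polynomials, orthogonal for exp(-x^2):
   H_0 = 1, H_1 = 2X, H_{n+2} = 2X H_{n+1} - 2(n+1) H_n.
   [hermite_pair n] = (H_n, H_{n+1}). *)
Fixpoint hermite_pair (R : nzRingType) (n : nat) : {poly R} * {poly R} :=
  match n with
  | 0 => (1, 2%:R *: 'X)
  | n'.+1 => let: (p, q) := hermite_pair R n' in
             (q, 2%:R *: 'X * q - (2 * n)%:R *: p)
  end.
Definition hermite (R : nzRingType) (n : nat) : {poly R} := (hermite_pair R n).1.

(* Lebesgue integral on R^n, computed as the iterated one-dimensional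
   Lebesgue integral over the n coordinates (coordinates beyond n are 0). *)
Fixpoint iint (R : realType) (n : nat) (F : (nat -> R) -> R) : R :=
  match n with
  | 0 => F (fun _ => 0)
  | n'.+1 => Rintegral (@lebesgue_measure R) setT
       (fun x => iint n' (fun v => F (fun i => if i is i'.+1 then v i' else x)))
  end.

Definition lebint (R : realType) (N : nat) (f : 'rV[R]_N -> R) : R :=
  iint N (fun v => f (\row_(i < N) v i)).

Definition in_CNA (R : realType) (N : nat) (y : 'rV[R]_N) : bool :=
  [forall i : 'I_N, forall j : 'I_N, (i <= j)%N ==> (y 0 j <= y 0 i)].

(* Unnormalized Lebesgue density on R^N of X_{t,k} (Bessel process of type
   A_{N-1}, multiplicity k, started in 0): supported on C_N^A, proportional to
   exp(-|y|^2/(2t)) prod_{i<j} (y_i - y_j)^{2k}. *)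
Definition bessel_density (R : realType) (N : nat) (k t : R) (y : 'rV[R]_N) : R :=
  if in_CNA y then
    expR (- (\sum_(i < N) y 0 i ^+ 2) / (2 * t)) *
    \prod_(i < N) \prod_(j < N | (i < j)%N) powR (y 0 i - y 0 j) (2 * k)
  else 0.

Definition bessel_expect (R : realType) (N : nat) (k t : R)
    (f : 'rV[R]_N -> R) : R :=
  lebint (fun y : 'rV[R]_N => f y * bessel_density k t y) / lebint (@bessel_density R N k t).

(* E[ f(Y) ] for Y ~ N(0, C) (C symmetric positive definite), via the density
   proportional to exp(- x C^{-1} x^T / 2). *)
Definition gauss_density (R : realType) (N : nat) (C : 'M[R]_N) (x : 'rV[R]_N) : R :=
  expR (- ((x *m invmx C *m x^T) 0 0) / 2).

Definition gauss_expect (R : realType) (N : nat) (C : 'M[R]_N)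
    (f : 'rV[R]_N -> R) : R :=
  lebint (fun x : 'rV[R]_N => f x * gauss_density C x) / lebint (gauss_density C).

Definition Smat (R : realType) (N : nat) (z : 'rV[R]_N) : 'M[R]_N :=
  \matrix_(i < N, j < N)
     if i == j then 1 + \sum_(l < N | l != i) (z 0 i - z 0 l) ^- 2
     else - (z 0 i - z 0 j) ^- 2.

(* Main.v *)
Require Import Defs.
From HB Require Import structures.
From mathcomp Require Import all_boot all_order all_algebra.
From mathcomp Require Import all_classical all_reals all_analysis.
From mathcomp Require Import measurable_realfun ring lra.
Import Order.TTheory GRing.Theory Num.Theory.
Import numFieldNormedType.Exports.
Local Open Scope classical_set_scope.
Local Open Scope ring_scope.

(** With [c := sqrt (2 k t)], the density of [X - c z] at [x] is proportional to
    [exp (- |x|^2 / (2 t))] times the product over [i < j] of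
    [((1 + w)_+ exp (- w)) ^ (2 k)], where
    [w = (x_i - x_j) / (c (z_i - z_j))].  The factors [exp (- w)] cost nothing:
    the Hermite differential equation gives
    [z_i = sum_(j != i) 1 / (z_i - z_j)], so the linear terms cancel.  Since
    [1 + w <= exp w], each factor is at most [1], whence the Gaussian
    [exp (- |x|^2 / (2 t))] dominates uniformly in [k]; and
    [2 k (ln (1 + w) - w)] tends to
    [- (x_i - x_j)^2 / (2 t (z_i - z_j)^2)], which yields
    [exp (- x S x^T / (2 t))] pointwise.  Dominated convergence concludes. *)

(** * Iterated integrals: dominated convergence, translation, positivity *)

Section iterated_integral.
Set Implicit Arguments.
Unset Strict Implicit.
Variable R : realType.
Local Notation mu := (@lebesgue_measure R).

Definition vcons (x : R) (v : nat -> R) (i : nat) : R :=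
  if i is i'.+1 then v i' else x.

(** Only the first [n] coordinates are asked to converge, so the notion passes to slices
    [F (vcons x v)] with one coordinate fewer. The sequential form is the one that dominated
    convergence handles. *)
Definition seq_continuous n (F : (nat -> R) -> R) :=
  forall (u : nat -> nat -> R) (v : nat -> R),
    (forall i, (i < n)%N -> u m i @[m --> \oo] --> v i) ->
    F (u m) @[m --> \oo] --> F v.

(** A product majorant keeps its shape when a coordinate is frozen: the factor [g x] is absorbed
    into the constant. *)
Definition dominated (g : R -> R) (C : R) n (F : (nat -> R) -> R) :=
  forall v, `|F v| <= C * \prod_(i < n) g (v i).

Lemma iintS n (F : (nat -> R) -> R) :
  iint n.+1 F = Rintegral mu setT (fun x => iint n (fun v => F (vcons x v))).
Proof. by []. Qed.

Lemma seq_continuous_vcons n F x :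
  seq_continuous n.+1 F -> seq_continuous n (fun v => F (vcons x v)).
Proof.
move=> cF u v uv; apply: (cF (fun m => vcons x (u m))) => -[|i] ilt /=.
  exact: cvg_cst.
exact: uv.
Qed.

Section dominating_function.
Variable g : R -> R.
Hypothesis g0 : forall x, 0 <= g x.
Hypothesis g1 : forall x, g x <= 1.
Hypothesis ig : mu.-integrable setT (EFin \o g).

Lemma dominated_vcons C n F x :
  dominated g C n.+1 F -> dominated g (C * g x) n (fun v => F (vcons x v)).
Proof.
move=> dF v; apply: (le_trans (dF _)).
by rewrite big_ord_recl/= mulrA.
Qed.

(** Bounding [g x] by 1 loses the decay in [x], but yields one constant for all [x], as needed when
    [x] runs along a convergent sequence. *)
Lemma dominated_vcons_unif C n F x : 0 <= C ->
  dominated g C n.+1 F -> dominated g C n (fun v => F (vcons x v)).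
Proof.
move=> C0 dF v; apply: (le_trans (dominated_vcons x dF v)).
apply: ler_wpM2r; first by apply: prodr_ge0.
by rewrite ler_piMr.
Qed.

Let mass := Rintegral mu setT g.

Let mass_ge0 : 0 <= mass. Proof. exact: Rintegral_ge0. Qed.

Let iint_bounded n := forall F (C : R), 0 <= C ->
  seq_continuous n F -> dominated g C n F -> `|iint n F| <= C * mass ^+ n.

Let iint_cvg_prop n :=
  forall (F_ : nat -> (nat -> R) -> R) F (C : R), 0 <= C ->
  (forall m, seq_continuous n (F_ m)) -> seq_continuous n F ->
  (forall m, dominated g C n (F_ m)) -> dominated g C n F ->
  (forall v, F_ m v @[m --> \oo] --> F v) ->
  iint n (F_ m) @[m --> \oo] --> iint n F.

Let inner_continuous n F (C : R) : iint_cvg_prop n -> 0 <= C ->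
  seq_continuous n.+1 F -> dominated g C n.+1 F ->
  continuous (fun x => iint n (fun v => F (vcons x v))).
Proof.
move=> cvg_n C0 cF dF x; apply/(@cvg_nbhsP _ R^o) => u ux.
apply: (cvg_n (fun m v => F (vcons (u m) v)) _ C) => //.
- by move=> m; exact: seq_continuous_vcons.
- exact: seq_continuous_vcons.
- by move=> m; exact: dominated_vcons_unif.
- exact: dominated_vcons_unif.
- by move=> v; apply: cF => -[|i] _ //=; exact: cvg_cst.
Qed.

(** Here the factor [g x] is retained: it provides the integrable majorant for the outer
    integral. *)
Let inner_bound n F (C x : R) : iint_bounded n -> 0 <= C ->
  seq_continuous n.+1 F -> dominated g C n.+1 F ->
  `|iint n (fun v => F (vcons x v))| <= C * mass ^+ n * g x.
Proof.
move=> bnd_n C0 cF dF; rewrite mulrAC; apply: bnd_n; first by rewrite mulr_ge0.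
  exact: seq_continuous_vcons.
exact: dominated_vcons.
Qed.

Let integrable_scale C : mu.-integrable setT (EFin \o (fun x => C * g x)).
Proof. by rewrite /comp; under eq_fun do rewrite EFinM; exact: integrableZl. Qed.

Let inner_integrable n F (C : R) : iint_bounded n -> iint_cvg_prop n -> 0 <= C ->
  seq_continuous n.+1 F -> dominated g C n.+1 F ->
  mu.-integrable setT (EFin \o (fun x => iint n (fun v => F (vcons x v)))).
Proof.
move=> bnd_n cvg_n C0 cF dF.
apply: (le_integrable _ _ _ (integrable_scale (C * mass ^+ n))) => //.
  apply/measurable_EFinP; apply: continuous_measurable_fun.
  exact: inner_continuous cvg_n C0 cF dF.
move=> x _ /=; rewrite lee_fin; apply: (le_trans _ (ler_norm _)).
exact: inner_bound.
Qed.

(* Measurability of the inner integrals comes from their continuity, which is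
   itself an instance of the convergence statement one dimension lower. *)
Let iint_bounded_cvg n : iint_bounded n /\ iint_cvg_prop n.
Proof.
elim: n => [|n [bnd_n cvg_n]].
  split=> [F C C0 _ dF|F_ F C C0 _ _ _ _ cF]; last exact: cF.
  by rewrite expr0 (le_trans (dF _))// big_ord0.
split.
  move=> F C C0 cF dF; rewrite iintS.
  have iF := inner_integrable bnd_n cvg_n C0 cF dF.
  apply: (le_trans (le_normr_Rintegral _ _)) => //.
  rewrite exprS [mass * _]mulrC mulrA -RintegralZl//.
  apply: le_Rintegral => //.
  - by apply: integrable_norm.
  - by move=> x _; exact: inner_bound.
move=> F_ F C C0 cF_ cF dF_ dF F_F; rewrite iintS.
under eq_fun do rewrite iintS.
apply: fine_cvg.
have := integrable_fin_num measurableT (inner_integrable bnd_n cvg_n C0 cF dF).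
move=> /fineK ->.
have [|||||//] := @dominated_convergence _ _ _ mu setT measurableT
  (fun m x => (iint n (fun v => F_ m (vcons x v)))%:E)
  (fun x => (iint n (fun v => F (vcons x v)))%:E)
  (fun x => (C * mass ^+ n * g x)%:E).
- move=> m; apply/measurable_EFinP; apply: continuous_measurable_fun.
  exact: inner_continuous cvg_n C0 (cF_ m) (dF_ m).
- apply/measurable_EFinP; apply: continuous_measurable_fun.
  exact: inner_continuous cvg_n C0 cF dF.
- apply: aeW => x _; apply: cvg_EFin; first by apply: nearW.
  apply: (cvg_n (fun m v => F_ m (vcons x v)) _ C) => //.
  + by move=> m; exact: seq_continuous_vcons.
  + exact: seq_continuous_vcons.
  + by move=> m; exact: dominated_vcons_unif.
  + exact: dominated_vcons_unif.
- exact: integrable_scale.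
- by apply: aeW => x m _; rewrite lee_fin; exact: inner_bound.
Qed.

Lemma iint_cvg n (F_ : nat -> (nat -> R) -> R) F (C : R) : 0 <= C ->
  (forall m, seq_continuous n (F_ m)) -> seq_continuous n F ->
  (forall m, dominated g C n (F_ m)) -> dominated g C n F ->
  (forall v, F_ m v @[m --> \oo] --> F v) ->
  iint n (F_ m) @[m --> \oo] --> iint n F.
Proof. exact: (iint_bounded_cvg n).2. Qed.

Lemma iint_continuous n F (C : R) : 0 <= C ->
  seq_continuous n.+1 F -> dominated g C n.+1 F ->
  continuous (fun x => iint n (fun v => F (vcons x v))).
Proof. exact: inner_continuous (iint_bounded_cvg n).2. Qed.

Lemma iint_integrable n F (C : R) : 0 <= C ->
  seq_continuous n.+1 F -> dominated g C n.+1 F ->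
  mu.-integrable setT (EFin \o (fun x => iint n (fun v => F (vcons x v)))).
Proof. by have [] := iint_bounded_cvg n; exact: inner_integrable. Qed.

Lemma iintZ n F (C a : R) : 0 <= C -> seq_continuous n F -> dominated g C n F ->
  iint n (fun v => a * F v) = a * iint n F.
Proof.
elim: n F C => // n IH F C C0 cF dF; rewrite !iintS -RintegralZl//; last first.
  exact: iint_integrable C0 cF dF.
apply: eq_Rintegral => x _; apply: (IH (fun v => F (vcons x v)) C) => //.
  exact: seq_continuous_vcons.
exact: dominated_vcons_unif.
Qed.

(** The substitution rule applied here concerns nonnegative integrands, so [G] is split into its
    positive and negative parts, both continuous. *)
Lemma Rintegral_shift (G : R -> R) a : continuous G ->
  Rintegral mu setT (fun x => G (x - a)) = Rintegral mu setT G.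
Proof.
move=> cG.
have F'E : derive1 (fun x : R => x - a) = cst 1.
  apply/funext => x; rewrite derive1E deriveB// derive_id derive_cst subr0//.
have ge0 (H : R -> R) : continuous H -> (forall x, 0 <= H x) ->
    (\int[mu]_x (H (x - a))%:E = \int[mu]_x (H x)%:E)%E.
  move=> cH H0; symmetry.
  rewrite (@increasing_ge0_integration_by_substitutionT R (fun x => x - a) H)//.
  - by apply: eq_integral => x _; rewrite F'E /= !fctE mulr1.
  - by move=> x y xy; rewrite ltrD2r.
  - by rewrite F'E => ?; exact: cvg_cst.
  - by rewrite F'E; exact: is_cvg_cst.
  - by rewrite F'E; exact: is_cvg_cst.
  - exact: cvg_addrr_Ny.
  - exact: cvg_addrr.
rewrite /Rintegral; congr fine; rewrite integralE [in RHS]integralE.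
have funeposE (K : R -> R) : (fun x => (K x)%:E)^\+%E =
    fun x => (Num.max (K x) 0)%:E by apply/funext => x; rewrite funeposE EFin_max.
have funenegE (K : R -> R) : (fun x => (K x)%:E)^\-%E =
    fun x => (Num.max (- K x) 0)%:E by apply/funext => x; rewrite funenegE EFin_max.
rewrite !funeposE !funenegE; congr (_ - _)%E.
  apply: (ge0 (fun x => Num.max (G x) 0)) => [x|x]; last by rewrite le_max lexx orbT.
  by apply: (@continuous_max _ _ G (cst 0)); [exact: cG|exact: cvg_cst].
apply: (ge0 (fun x => Num.max (- G x) 0)) => [x|x]; last by rewrite le_max lexx orbT.
by apply: (@continuous_max _ _ (fun x => - G x) (cst 0));
  [apply: cvgN; exact: cG|exact: cvg_cst].
Qed.

(** The translation is peeled off one coordinate at a time. The last hypothesis settles the base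
    case: [iint 0] evaluates at the zero sequence, and the shift [a] must be invisible there. *)
Lemma iint_shift n F (C : R) (a : nat -> R) : 0 <= C ->
  seq_continuous n F -> dominated g C n F ->
  (forall u v, (forall i, (i < n)%N -> u i = v i) -> F u = F v) ->
  iint n (fun v => F (fun i => v i - a i)) = iint n F.
Proof.
elim: n F C a => [|n IH] F C a C0 cF dF eF; first exact: eF.
rewrite !iintS -[RHS](@Rintegral_shift _ (a 0%N)); last first.
  exact: iint_continuous C0 cF dF.
apply: eq_Rintegral => x _.
rewrite -(IH (fun v => F (vcons (x - a 0%N) v)) C (fun i => a i.+1)) //.
- by congr iint; apply/funext => v; apply: eF => -[|i].
- exact: seq_continuous_vcons.
- exact: dominated_vcons_unif.
- by move=> u v uv; apply: eF => -[|i]//; exact: uv.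
Qed.

(** If the integral vanished, the nonnegative inner integral [phi] would be 0 almost everywhere.
    Since [phi] is positive everywhere, the exceptional null set would then contain the interval
    from 0 to 1. *)
Lemma iint_gt0 n F (C : R) : 0 <= C ->
  seq_continuous n F -> dominated g C n F -> (forall v, 0 < F v) ->
  0 < iint n F.
Proof.
elim: n F C => [|n IH] F C C0 cF dF F0; first exact: F0.
set phi := fun x => iint n (fun v => F (vcons x v)).
have phi0 x : 0 < phi x.
  apply: (IH (fun v => F (vcons x v)) C) => //.
    exact: seq_continuous_vcons.
  exact: dominated_vcons_unif.
have iphi := @iint_integrable n F C C0 cF dF.
rewrite iintS lt_neqAle Rintegral_ge0 ?andbT; last by move=> x _; exact/ltW/phi0.
apply/eqP => phiE.
have : (\int[mu]_x `|(phi x)%:E| = 0)%E.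
  under eq_integral do rewrite gee0_abs ?lee_fin ?(ltW (phi0 _))//.
  rewrite -[LHS]fineK; last exact: integrable_fin_num iphi.
  by congr EFin; exact: esym phiE.
move/(ae_eq_integral_abs mu measurableT).
have /measurable_int mphi := iphi.
move=> /(_ mphi) [A [mA A0 AT]].
have : (mu `[0%R, 1%R]%classic <= mu A)%E.
  apply: le_measure; rewrite ?inE//.
  move=> x _; apply: AT => /= /(_ I) [] /eqP; rewrite gt_eqF//; exact: phi0.
by rewrite A0 lebesgue_measure_itv/= lte_fin ltr01 oppr0 adde0 lee_fin ler10.
Qed.

End dominating_function.
End iterated_integral.

(** * Hermite polynomials and the equilibrium relation of their zeros *)

Section hermite_zeros.
Set Implicit Arguments.
Unset Strict Implicit.
Variable R : realFieldType.

Lemma hermite0 : hermite R 0 = 1. Proof. by []. Qed.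

Lemma hermite1 : hermite R 1 = 2%:R *: 'X. Proof. by []. Qed.

Lemma hermiteSS n :
  hermite R n.+2 = 2%:R *: 'X * hermite R n.+1 - (2 * n.+1)%:R *: hermite R n.
Proof. by rewrite /hermite /=; case: (hermite_pair R n) => p q. Qed.

Lemma deriv_hermite n : (hermite R n.+1)^`() = (2 * n.+1)%:R *: hermite R n.
Proof.
(* Two consecutive indices go through the induction together, because the recurrence reaches back
   two steps. *)
suff: (hermite R n.+1)^`() = (2 * n.+1)%:R *: hermite R n /\
      (hermite R n.+2)^`() = (2 * n.+2)%:R *: hermite R n.+1 by case.
elim: n => [|n [IH1 IH2]].
  rewrite hermiteSS hermite0 hermite1 derivB derivM !derivZ derivX derivC.
  by split; rewrite -!mul_polyC !rmorph_nat; ring.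
split=> //; rewrite hermiteSS derivB derivM !derivZ derivX IH1 IH2 (hermiteSS n).
by rewrite -!mul_polyC !rmorph_nat !natrM !mulrS; ring.
Qed.

(** Applying [deriv_hermite] twice expresses both derivatives by lower Hermite polynomials, and the
    three-term recurrence relates them. *)
Lemma hermite_ode n : (hermite R n)^`()^`() =
  2%:R *: ('X * (hermite R n)^`()) - (2 * n)%:R *: hermite R n.
Proof.
case: n => [|n]; first by rewrite hermite0 !derivC muln0 scale0r mulr0 scaler0 subr0.
rewrite deriv_hermite; case: n => [|n].
  rewrite hermite0 hermite1 derivZ derivC scaler0.
  by rewrite -!mul_polyC !rmorph_nat; ring.
rewrite derivZ deriv_hermite (hermiteSS n).
by rewrite -!mul_polyC !rmorph_nat !natrM !mulrS; ring.
Qed.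

Lemma size_hermite n : size (hermite R n) = n.+1.
Proof.
suff: size (hermite R n) = n.+1 /\ size (hermite R n.+1) = n.+2 by case.
elim: n => [|n [IH1 IH2]].
  by rewrite hermite0 hermite1 size_poly1 size_scale ?size_polyX ?pnatr_eq0.
split=> //; rewrite hermiteSS -scalerAl size_polyDl.
  by rewrite size_scale ?pnatr_eq0// mulrC size_mulX ?IH2// -size_poly_eq0 IH2.
rewrite size_polyN (leq_ltn_trans (size_scale_leq _ _))// IH1.
by rewrite size_scale ?pnatr_eq0// mulrC size_mulX ?IH2// -size_poly_eq0 IH2.
Qed.

(** This is the logarithmic derivative of a product of linear factors. *)
Lemma deriv_prod_XsubC (I : Type) (r : seq I) (P : pred I) (a : I -> R) x :
  (forall i, P i -> x != a i) ->
  (\prod_(i <- r | P i) ('X - (a i)%:P))^`().[x] =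
  (\prod_(i <- r | P i) ('X - (a i)%:P)).[x] * \sum_(i <- r | P i) (x - a i)^-1.
Proof.
move=> xa; elim: r => [|i r IH].
  by rewrite !big_nil derivC horner0 mulr0.
rewrite !big_cons; case: ifP => // Pi.
rewrite derivM hornerD !hornerM IH derivXsubC hornerXsubC hornerC.
have := xa i Pi; rewrite -subr_eq0 => h.
by field.
Qed.

Variables (N : nat) (z : 'rV[R]_N).
Hypothesis zdecr : forall i j : 'I_N, (i < j)%N -> z 0 j < z 0 i.
Hypothesis zroot : forall i : 'I_N, root (hermite R N) (z 0 i).

Lemma zeros_inj (i j : 'I_N) : i != j -> z 0 i != z 0 j.
Proof.
rewrite neq_ltn => /orP[ij|ij]; first by rewrite gt_eqF// zdecr.
by rewrite lt_eqF// zdecr.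
Qed.

Lemma hermite_prod :
  hermite R N = lead_coef (hermite R N) *: \prod_(i < N) ('X - (z 0 i)%:P).
Proof.
pose rs := [seq z 0 i | i <- enum 'I_N].
have sz : size rs = N by rewrite size_map size_enum_ord.
rewrite -big_enum/= -(big_map (fun i => z 0 i) predT (fun a => 'X - a%:P)).
apply: all_roots_prod_XsubC; first by rewrite size_hermite sz.
  by apply/allP => a /mapP[i _ ->].
rewrite uniq_rootsE map_inj_uniq ?enum_uniq// => i j /eqP.
by apply: contraTeq => /zeros_inj.
Qed.

(* With H = (X - z_i) q one has H'(z_i) = q(z_i) and H''(z_i) = 2 q'(z_i), so
   the differential equation reads q'(z_i) / q(z_i) = z_i. *)
Lemma hermite_zerosE i : \sum_(j < N | j != i) (z 0 i - z 0 j)^-1 = z 0 i.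
Proof.
pose q := \prod_(j < N | j != i) ('X - (z 0 j)%:P).
have l0 : lead_coef (hermite R N) != 0.
  by rewrite lead_coef_eq0 -size_poly_eq0 size_hermite.
have HE : hermite R N = lead_coef (hermite R N) *: (('X - (z 0 i)%:P) * q).
  by rewrite [LHS]hermite_prod (bigD1 i).
have q0 : q.[z 0 i] != 0.
  rewrite /q horner_prod; apply/prodf_neq0 => j ji.
  by rewrite !hornerE subr_eq0 eq_sym zeros_inj.
have := congr1 (horner^~ (z 0 i)) (hermite_ode N).
rewrite {1 2}HE /= hornerD hornerN !hornerZ (rootP (zroot i)) mulr0 subr0.
rewrite !derivZ !hornerZ hornerM !hornerZ !derivM !derivXsubC !mul1r.
rewrite derivD derivM derivXsubC mul1r !(hornerE) subrr !mul0r addr0.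
rewrite deriv_prod_XsubC; last by move=> j ji; rewrite eq_sym zeros_inj.
rewrite -/q; set s := \sum_(_ < _ | _) _ => h.
apply: (mulfI (mulf_neq0 l0 q0)); move: h => /= h; lra.
Qed.

End hermite_zeros.

(** * Sums over pairs: the quadratic form of [Smat z] and the pairing with the zeros *)

Section pairs.
Set Implicit Arguments.
Unset Strict Implicit.
Variables (R : realType) (N : nat).

Lemma sum_neq_pairs (F : 'I_N -> 'I_N -> R) :
  \sum_(i < N) \sum_(j < N | j != i) F i j =
  \sum_(i < N) \sum_(j < N | (i < j)%N) (F i j + F j i).
Proof.
under [RHS]eq_bigr do rewrite big_split/=.
rewrite big_split/= [X in _ + X](exchange_big_dep xpredT)//= -big_split/=.
apply: eq_bigr => i _; rewrite (bigID (fun j : 'I_N => (i < j)%N))/=.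
congr (_ + _); apply: eq_bigl => j.
  by rewrite -val_eqE/=; case: ltngtP.
by rewrite -val_eqE/=; case: ltngtP.
Qed.

Variables z : 'rV[R]_N.

(** [Smat z] is the identity plus the Laplacian of the complete graph with weights
    [(z 0 i - z 0 j) ^- 2], hence a sum of squares. Both the invertibility and the shape of the
    limit density come from it. *)
Lemma Smat_form (x : 'rV[R]_N) : (x *m Smat z *m x^T) 0 0 =
  \sum_(i < N) x 0 i ^+ 2 +
  \sum_(i < N) \sum_(j < N | (i < j)%N) ((x 0 i - x 0 j) / (z 0 i - z 0 j)) ^+ 2.
Proof.
transitivity (\sum_(i < N) x 0 i ^+ 2 + \sum_(i < N) \sum_(j < N | j != i)
    (z 0 i - z 0 j) ^- 2 * (x 0 i ^+ 2 - x 0 i * x 0 j)).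
  rewrite -big_split/= mxE; under [LHS]eq_bigr => j _ do rewrite [x^T _ _]mxE mxE mulr_suml.
  rewrite exchange_big/=; apply: eq_bigr => i _.
  rewrite (bigD1 i)//= !mxE eqxx mulrDr mulrDl mulr1 -expr2 -addrA; congr (_ + _).
  rewrite mulr_sumr mulr_suml -big_split/=; apply: eq_bigr => j ji.
  by rewrite !mxE eq_sym (negbTE ji); ring.
congr (_ + _); rewrite sum_neq_pairs; apply: eq_bigr => i _; apply: eq_bigr => j _.
rewrite -[z 0 j - _]opprB sqrrN exprMn exprVn; ring.
Qed.

(** A row [v] in the left kernel makes the quadratic form vanish, and the form is at least the sum
    of the squares of the entries of [v]. *)
Lemma Smat_unit : Smat z \in unitmx.
Proof.
rewrite -row_free_unit -kermx_eq0; apply/eqP/row_matrixP => i; rewrite row0.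
set v := row i _.
have vS : v *m Smat z = 0 by rewrite /v -row_mul mulmx_ker row0.
have := Smat_form v; rewrite vS mul0mx mxE => /esym/eqP.
have sq0 : 0 <= \sum_(i < N) v 0 i ^+ 2 by apply: sumr_ge0 => j _; exact: sqr_ge0.
rewrite paddr_eq0//; last first.
  by apply: sumr_ge0 => j _; apply: sumr_ge0 => l _; exact: sqr_ge0.
rewrite psumr_eq0 => [/andP[/allP v0 _]|j _]; last exact: sqr_ge0.
apply/rowP => j; rewrite [RHS]mxE; apply/eqP.
by have := v0 j; rewrite mem_index_enum => /(_ isT); rewrite /= expf_eq0.
Qed.

(** The precision matrix is [t^-1 *: Smat z]. Its density is factored over pairs so that the limit
    can be taken factor by factor. *)
Lemma gauss_density_form (t : R) x : 0 < t ->
  gauss_density (t *: invmx (Smat z)) x =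
  expR (- (\sum_(i < N) x 0 i ^+ 2) / (2 * t)) *
  \prod_(i < N) \prod_(j < N | (i < j)%N)
    expR (- ((x 0 i - x 0 j) / (z 0 i - z 0 j)) ^+ 2 / (2 * t)).
Proof.
move=> t0; rewrite /gauss_density.
have -> : invmx (t *: invmx (Smat z)) = t^-1 *: Smat z.
  by rewrite invmxZ ?invmxK// unitmxZ ?unitmx_inv ?Smat_unit// unitfE gt_eqF.
under [X in _ = _ * X]eq_bigr do rewrite -expR_sum.
rewrite -expR_sum -expRD; congr expR.
rewrite -scalemxAr -scalemxAl mxE Smat_form.
have t1 : t != 0 by rewrite gt_eqF.
under [X in _ = _ + X]eq_bigr do rewrite -mulr_suml sumrN.
rewrite -mulr_suml sumrN.
by field.
Qed.

Hypothesis zdecr : forall i j : 'I_N, (i < j)%N -> z 0 j < z 0 i.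
Hypothesis zroot : forall i : 'I_N, root (hermite R N) (z 0 i).

(** Substitute the equilibrium relation for [z 0 i] on the right and group the terms (i, j) and (j,
    i), whose reciprocals have opposite signs. This identity makes the linear terms cancel after
    recentering. *)
Lemma hermite_zeros_pairing (x : 'rV[R]_N) :
  \sum_(i < N) \sum_(j < N | (i < j)%N) (x 0 i - x 0 j) / (z 0 i - z 0 j) =
  \sum_(i < N) x 0 i * z 0 i.
Proof.
under [RHS]eq_bigr => i _ do rewrite -(hermite_zerosE zdecr zroot i) mulr_sumr.
rewrite sum_neq_pairs; apply: eq_bigr => i _; apply: eq_bigr => j _.
by rewrite -[z 0 j - _]opprB invrN; ring.
Qed.

End pairs.

(** * Continuity, bounds and asymptotics of one tilted factor *)

Section tilted_factor.
Set Implicit Arguments.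
Unset Strict Implicit.
Variable R : realType.

(** The remainder [f] has derivative x^2 / (1 + x), at most 2 w^2 in absolute value between 0 and
    [w] because 1 + x is at least 1/2 there. The mean value theorem supplies the last factor |w|. *)
Lemma ln1D_taylor2 (w : R) : `|w| <= 1 / 2 ->
  `|ln (1 + w) - w + w ^+ 2 / 2| <= 2 * `|w| ^+ 3.
Proof.
pose f (x : R) := ln (1 + x) - x + x ^+ 2 / 2.
pose df (x : R) := x ^+ 2 / (1 + x).
have f0 : f 0 = 0 by rewrite /f addr0 ln1 subr0 expr0n mul0r addr0.
have dfE (x : R) : -1 < x -> is_derive x 1 f (df x).
  move=> x1; have x0 : 0 < 1 + x by lra.
  have dln : is_derive (1 + x) 1 (@ln R) (1 + x)^-1 by exact: is_derive1_ln.
  rewrite /f; apply: is_derive_eq.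
  rewrite /df /GRing.scale/=; field; lra.
have cf (x : R) : -1 < x -> {for x, continuous f}.
  move=> /dfE[dfx _]; exact/differentiable_continuous/derivable1_diffP.
have dfle (x : R) : `|x| <= `|w| -> `|w| <= 1 / 2 -> `|df x| <= 2 * `|w| ^+ 2.
  move=> xw w2; have := ler_norm (- x); rewrite normrN => x1.
  rewrite /df normrM normrX normfV [`|1 + x|]ger0_norm; last lra.
  rewrite ler_pdivrMr; last lra.
  have := ler_pM (normr_ge0 _) (normr_ge0 _) xw xw; rewrite -!expr2 => h.
  have w0 := sqr_ge0 `|w|; nra.
move=> w2; have := ler_norm w; have := ler_norm (- w); rewrite normrN => wl wr.
have [w0|w0] := leP 0 w.
  have [c|c|c] := @MVT_segment R f df 0 w w0.
  - by rewrite in_itv/= => /andP[c0 _]; apply: dfE; lra.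
  - apply: continuous_in_subspaceT => x; rewrite inE/= in_itv/= => /andP[x0 _].
    by apply: cf; lra.
  - rewrite in_itv/= => /andP[c0 cw]; rewrite f0 !subr0 -/(f w) => ->.
    rewrite normrM exprSr mulrA ler_wpM2r//; apply: dfle => //.
    by rewrite !ger0_norm.
have [c|c|c] := @MVT_segment R f df w 0 (ltW w0).
- by rewrite in_itv/= => /andP[c0 _]; apply: dfE; lra.
- apply: continuous_in_subspaceT => x; rewrite inE/= in_itv/= => /andP[x0 _].
  by apply: cf; lra.
- rewrite in_itv/= => /andP[cw c0]; rewrite f0 !sub0r -/(f w) => /eqP.
  rewrite -eqr_opp mulrN !opprK => /eqP ->.
  rewrite normrM exprSr mulrA ler_wpM2r//; apply: dfle => //.
  by rewrite !ler0_norm ?(ltW w0)// lerN2.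
Qed.

Lemma continuous_powR_max0 (a : R) : 0 < a ->
  continuous (fun x : R => powR (Num.max 0 x) a).
Proof.
move=> a0 x; rewrite /continuous_at/=; have [x0|x0|<-] := ltgtP 0 x.
- have : (y : R) `^ a @[y --> x] --> x `^ a.
    apply: (@differentiable_continuous _ _ _ x (fun y : R => y `^ a)); apply/derivable1_diffP.
    by apply: derivable_powR; rewrite in_itv/= x0.
  rewrite /=; apply: cvg_trans; apply: near_eq_cvg.
  near=> y; rewrite max_r//; apply/ltW; near: y.
  exact: lt_nbhsr.
- have : cst (0 `^ a) y @[y --> x] --> 0 `^ a by exact: cvg_cst.
  apply: cvg_trans; apply: near_eq_cvg; near=> y; rewrite max_l//; apply/ltW; near: y.
  by apply: lt_nbhsl.
- rewrite powR0 ?gt_eqF//; apply/cvgr0Pnorm_lt => e e0.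
  have d0 : 0 < e `^ a^-1 by rewrite powR_gt0.
  near=> y; rewrite ger0_norm ?powR_ge0//.
  have : Num.max 0 y < e `^ a^-1.
    rewrite gt_max d0/=; near: y.
    exact: lt_nbhsl.
  move=> /(gt0_ltr_powR a0) h.
  have := h _ _; rewrite -powRrM mulVf ?gt_eqF// powRr1 ?ltW// => -> //.
    by rewrite nnegrE le_max lexx.
  by rewrite nnegrE ltW.
Unshelve. all: end_near. Qed.

Definition tilt (w : R) := Num.max 0 (1 + w) * expR (- w).

Lemma tilt_ge0 w : 0 <= tilt w.
Proof. by rewrite mulr_ge0 ?expR_ge0// le_max lexx. Qed.

Lemma tilt_le1 w : tilt w <= 1.
Proof.
rewrite /tilt expRN ler_pdivrMr ?expR_gt0// mul1r ge_max expR_ge0/=.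
exact: expR_ge1Dx.
Qed.

Lemma tiltE w : tilt w = Num.max 0 ((1 + w) * expR (- w)).
Proof. by rewrite /tilt maxr_pMl ?expR_ge0// mul0r. Qed.

Lemma continuous_powR_tilt (a : R) : 0 < a ->
  continuous (fun w => powR (tilt w) a).
Proof.
move=> a0 w; under eq_fun do rewrite tiltE.
apply: (@cvg_comp _ _ _ (fun w : R => (1 + w) * expR (- w))
  (fun x => powR (Num.max 0 x) a)); last exact: continuous_powR_max0.
apply: cvgM; first by apply: cvgD; [exact: cvg_cst|exact: cvg_id].
apply: (@cvg_comp _ _ _ (fun w : R => - w)); last exact: continuous_expR.
exact: cvgN.
Qed.

(* 2k (ln (1 + w) - w) ~ - k w^2 with w = a / c and 2k = c^2 / t. *)
Lemma powR_tilt_cvg (a t : R) (c : nat -> R) : 0 < t ->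
  c m @[m --> \oo] --> +oo ->
  powR (tilt (a / c m)) (c m ^+ 2 / t) @[m --> \oo] --> expR (- a ^+ 2 / (2 * t)).
Proof.
move=> t0 coo.
pose e m := c m ^+ 2 / t * (ln (1 + a / c m) - a / c m).
have ecvg : e m @[m --> \oo] --> - a ^+ 2 / (2 * t).
  apply/cvgrPdist_le => eps eps0.
  near=> m.
  (* The first bound gives |a / c| at most 1/2, the range of the Taylor estimate; the second brings
     its remainder 2 |a|^3 / (t c) below [eps]. *)
  have c2a : 2 * `|a| + 1 <= c m by near: m; move/cvgryPge: coo; exact.
  have ceps : 2 * `|a| ^+ 3 / (t * eps) <= c m by near: m; move/cvgryPge: coo; exact.
  have a0 := normr_ge0 a.
  have c0 : 0 < c m by lra.
  have w2 : `|a / c m| <= 1 / 2.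
    rewrite normrM normfV [`|c m|]gtr0_norm// ler_pdivrMr//; lra.
  have := ln1D_taylor2 w2; set L := ln _ => hL.
  have -> : - a ^+ 2 / (2 * t) - e m =
      - (c m ^+ 2 / t) * (L - a / c m + (a / c m) ^+ 2 / 2).
    by rewrite /e -/L; field; rewrite !gt_eqF.
  rewrite normrM normrN [`|c m ^+ 2 / t|]ger0_norm; last first.
    by rewrite divr_ge0 ?sqr_ge0 ?ltW.
  apply: (le_trans (ler_wpM2l _ hL)); first by rewrite divr_ge0 ?sqr_ge0 ?ltW.
  rewrite normrM normfV [`|c m|]gtr0_norm//.
  move: ceps; rewrite ler_pdivrMr ?mulr_gt0// => ceps.
  have -> : c m ^+ 2 / t * (2 * (`|a| / c m) ^+ 3) = 2 * `|a| ^+ 3 / (t * c m).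
    by field; rewrite !gt_eqF.
  rewrite ler_pdivrMr ?mulr_gt0//; lra.
apply: (@cvg_trans _ (expR (e m) @[m --> \oo])); last first.
  by apply: (@cvg_comp _ _ _ e expR _ _ _ ecvg); exact: continuous_expR.
apply: near_eq_cvg; near=> m.
(* This forces 1 + a / c to be positive, so the truncation in [tilt] is inactive and the logarithm
   may be taken. *)
have c2a : `|a| + 1 <= c m by near: m; move/cvgryPge: coo; exact.
have a0 := normr_ge0 a.
have c0 : 0 < c m by lra.
have w1 : 0 < 1 + a / c m.
  have -> : 1 + a / c m = (c m + a) / c m by field; rewrite gt_eqF.
  rewrite divr_gt0//; have := ler_norm (- a); rewrite normrN; lra.
rewrite /tilt max_r ?(ltW w1)// /powR mulf_eq0 gt_eqF//= gt_eqF ?expR_gt0//=.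
rewrite lnM ?posrE ?expR_gt0// expRK; congr expR.
Unshelve. all: end_near. Qed.

End tilted_factor.

(** * Functions of row vectors and the Gaussian majorant *)

Section row_functions.
Set Implicit Arguments.
Unset Strict Implicit.
Variables (R : realType) (N : nat).

(** [iint_shift] translates by a sequence, so a row has to be extended to one. The empty row is
    separate because [inord] lands in a nonempty ordinal. *)
Lemma row_of_seq (y : 'rV[R]_N) : exists s : nat -> R, y = \row_(i < N) s i.
Proof.
case: N y => [|n] y; first by exists (cst 0); apply/rowP => -[].
by exists (fun i => y 0 (inord i)); apply/rowP => i; rewrite mxE inord_val.
Qed.

Definition coord_seq_continuous (h : 'rV[R]_N -> R) :=
  forall (y : nat -> 'rV[R]_N) (x : 'rV[R]_N),
    (forall i, y m 0 i @[m --> \oo] --> x 0 i) -> h (y m) @[m --> \oo] --> h x.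

Lemma continuous_coord_seq h : continuous h -> coord_seq_continuous h.
Proof.
move=> ch y x yx; apply: (@cvg_comp _ _ _ y h _ _ _ _ (ch x)).
apply/cvg_ballP => e e0.
have H : \forall m \near \oo, forall i : 'I_N, ball (x 0 i) e (y m 0 i).
  by apply: filter_forall => i; have /cvg_ballP := yx i; exact.
by apply: filterS H => m Hm; split=> // i j; rewrite (ord1 i).
Qed.

Lemma seq_continuous_row h : coord_seq_continuous h ->
  seq_continuous N (fun v => h (\row_(i < N) v i)).
Proof.
move=> ch u v uv; apply: (ch (fun m => \row_(i < N) u m i)) => i.
by rewrite mxE; under eq_fun do rewrite mxE; exact: uv.
Qed.

Definition gauss1 (t x : R) := expR (- x ^+ 2 / (2 * t)).

Lemma gauss1_ge0 t x : 0 <= gauss1 t x. Proof. exact: expR_ge0. Qed.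

Lemma gauss1_le1 t x : 0 < t -> gauss1 t x <= 1.
Proof.
by move=> t0; rewrite expR_le1 mulNr oppr_le0 divr_ge0 ?sqr_ge0// mulr_ge0// ltW.
Qed.

(** [gauss1 t] is a multiple of the normal density with standard deviation [Num.sqrt t]. *)
Lemma gauss1_integrable t : 0 < t ->
  (@lebesgue_measure R).-integrable setT (EFin \o gauss1 t).
Proof.
move=> t0; pose s := Num.sqrt t.
have s0 : s != 0 by rewrite gt_eqF// sqrtr_gt0.
have -> : EFin \o gauss1 t =
    fun x => ((normal_peak s)^-1%:E * (normal_pdf 0 s x)%:E)%E.
  apply/funext => x /=; rewrite -EFinM normal_pdfE// mulKf; last first.
    by rewrite gt_eqF// normal_peak_gt0.
  by rewrite /normal_fun subr0 sqr_sqrtr ?(ltW t0)// -mulr_natl.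
by apply: integrableZl => //; exact: integrable_normal_pdf.
Qed.

Lemma prod_gauss1 t (x : 'rV[R]_N) : \prod_(i < N) gauss1 t (x 0 i) =
  expR (- (\sum_(i < N) x 0 i ^+ 2) / (2 * t)).
Proof. by rewrite -expR_sum -mulr_suml sumrN. Qed.

(** The Gaussian of the norm factors over the coordinates, which is exactly a product majorant. *)
Lemma dominated_row C t (h : 'rV[R]_N -> R) :
  (forall x, `|h x| <= C * expR (- (\sum_(i < N) x 0 i ^+ 2) / (2 * t))) ->
  dominated (gauss1 t) C N (fun v => h (\row_(i < N) v i)).
Proof.
move=> hh v; rewrite (le_trans (hh _))// -prod_gauss1.
by under eq_bigr do rewrite mxE.
Qed.

End row_functions.

Lemma cvg_bigsum (R : realType) (T I : Type) (F : set_system T) {FF : Filter F}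
    (r : seq I) (P : pred I) (f : I -> T -> R) (l : I -> R) :
  (forall i, P i -> f i x @[x --> F] --> l i) ->
  \sum_(i <- r | P i) f i x @[x --> F] --> \sum_(i <- r | P i) l i.
Proof. by apply: cvg_big => //; exact: add_continuous. Qed.

Lemma cvg_bigprod (R : realType) (T I : Type) (F : set_system T) {FF : Filter F}
    (r : seq I) (P : pred I) (f : I -> T -> R) (l : I -> R) :
  (forall i, P i -> f i x @[x --> F] --> l i) ->
  \prod_(i <- r | P i) f i x @[x --> F] --> \prod_(i <- r | P i) l i.
Proof. by apply: cvg_big => //; exact: mul_continuous. Qed.

(** * Recentering the Bessel density and passing to the limit *)

Section limit_theorem.
Set Implicit Arguments.
Unset Strict Implicit.
Variables (R : realType) (N : nat) (z : 'rV[R]_N) (t : R).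
Hypothesis zdecr : forall i j : 'I_N, (i < j)%N -> z 0 j < z 0 i.
Hypothesis zroot : forall i : 'I_N, root (hermite R N) (z 0 i).
Hypothesis t0 : 0 < t.

Lemma bessel_densityE k (y : 'rV[R]_N) : 0 < k -> bessel_density k t y =
  expR (- (\sum_(i < N) y 0 i ^+ 2) / (2 * t)) *
  \prod_(i < N) \prod_(j < N | (i < j)%N) powR (Num.max 0 (y 0 i - y 0 j)) (2 * k).
Proof.
move=> k0; rewrite /bessel_density; case: ifPn => [/forallP yC|].
  congr (_ * _); apply: eq_bigr => i _; apply: eq_bigr => j ij.
  rewrite max_r// subr_ge0.
  by have /forallP/(_ j)/implyP := yC i; apply; exact: ltnW.
move=> /forallPn[i /forallPn[j]]; rewrite negb_imply -ltNge => /andP[ij yij].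
have {}ij : (i < j)%N.
  by rewrite ltn_neqAle ij andbT; apply: contraTneq yij => /ord_inj->; rewrite ltxx.
apply/esym/eqP; rewrite mulf_eq0; apply/orP; right.
apply/prodf_eq0; exists i => //; apply/prodf_eq0; exists j => //.
rewrite max_l; last by rewrite subr_le0 ltW.
by rewrite powR0// mulf_neq0// gt_eqF.
Qed.

(* The density of X - c z with c = sqrt (2 k t), up to a constant. *)
Definition recentered_density c (x : 'rV[R]_N) :=
  expR (- (\sum_(i < N) x 0 i ^+ 2) / (2 * t)) *
  \prod_(i < N) \prod_(j < N | (i < j)%N)
    powR (tilt ((x 0 i - x 0 j) / (z 0 i - z 0 j) / c)) (c ^+ 2 / t).

(** Each truncated difference is c (z_i - z_j) times [tilt w * expR w]. The product of the extra
    exponentials is evaluated by [hermite_zeros_pairing] and cancels the cross term of |x + c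
    z|^2. *)
Lemma bessel_density_recenter k : 0 < k -> exists2 A, A != 0 &
  forall x, bessel_density k t (x + Num.sqrt (2 * k * t) *: z) =
    A * recentered_density (Num.sqrt (2 * k * t)) x.
Proof.
move=> k0; set c := Num.sqrt _.
have c0 : 0 < c by rewrite sqrtr_gt0 !mulr_gt0.
have c2 : c ^+ 2 = 2 * k * t by rewrite sqr_sqrtr// !mulr_ge0// ltW.
have c2t : c ^+ 2 / t = 2 * k by rewrite c2 mulfK// gt_eqF.
(* This is the density at [c *: z]: at [x = 0] every [tilt] equals 1, and so does
   [recentered_density]. *)
exists (expR (- c ^+ 2 * (\sum_(i < N) z 0 i ^+ 2) / (2 * t)) *
  \prod_(i < N) \prod_(j < N | (i < j)%N) powR (c * (z 0 i - z 0 j)) (2 * k)).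
  rewrite mulf_neq0 ?gt_eqF ?expR_gt0//; apply: prodr_gt0 => i _.
  by apply: prodr_gt0 => j ij; rewrite powR_gt0// mulr_gt0// subr_gt0 zdecr.
move=> x; rewrite bessel_densityE// /recentered_density.
pose w i j := (x 0 i - x 0 j) / (z 0 i - z 0 j) / c.
have factor (i j : 'I_N) : (i < j)%N ->
    Num.max 0 ((x + c *: z) 0 i - (x + c *: z) 0 j) `^ (2 * k) =
    (c * (z 0 i - z 0 j)) `^ (2 * k) *
    (tilt (w i j) `^ (2 * k) * expR (w i j * (2 * k))).
  move=> ij; have zij : 0 < z 0 i - z 0 j by rewrite subr_gt0 zdecr.
  have w0 : 0 <= tilt (w i j) * expR (w i j).
    by apply: mulr_ge0; [exact: tilt_ge0|exact: expR_ge0].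
  have cz0 : 0 <= c * (z 0 i - z 0 j) by apply/ltW/mulr_gt0.
  rewrite expRM -!powRM ?w0 ?cz0 ?tilt_ge0 ?expR_ge0//.
  congr powR; rewrite /tilt -[_ * expR (- _) * _]mulrA expRN mulVf ?gt_eqF ?expR_gt0// mulr1.
  rewrite maxr_pMr// mulr0; congr Num.max.
  by rewrite !mxE /w; field; rewrite !gt_eqF.
rewrite c2t.
under [X in _ * X = _]eq_bigr do rewrite (eq_bigr _ (factor _)) !big_split/= -expR_sum.
rewrite !big_split/= -expR_sum.
have -> : \sum_(i < N) \sum_(j < N | (i < j)%N) w i j * (2 * k) =
    c / t * \sum_(i < N) x 0 i * z 0 i.
  rewrite -(hermite_zeros_pairing zdecr zroot) mulr_sumr; apply: eq_bigr => i _.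
  rewrite mulr_sumr; apply: eq_bigr => j _.
  have -> : c / t = 2 * k / c by rewrite -c2t; field; rewrite !gt_eqF.
  by rewrite /w; ring.
(* The last exponential, from the cross term, is the inverse of the one produced by the pairing. *)
have -> : expR (- (\sum_(i < N) (x + c *: z) 0 i ^+ 2) / (2 * t)) =
    expR (- c ^+ 2 * (\sum_(i < N) z 0 i ^+ 2) / (2 * t)) *
    expR (- (\sum_(i < N) x 0 i ^+ 2) / (2 * t)) *
    expR (- (c / t * \sum_(i < N) x 0 i * z 0 i)).
  rewrite -!expRD; congr expR.
  have -> : \sum_(i < N) (x + c *: z) 0 i ^+ 2 = \sum_(i < N) x 0 i ^+ 2 +
      2 * c * (\sum_(i < N) x 0 i * z 0 i) + c ^+ 2 * \sum_(i < N) z 0 i ^+ 2.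
    rewrite !mulr_sumr -!big_split/=; apply: eq_bigr => i _; rewrite !mxE; ring.
  by field; rewrite gt_eqF.
set E := c / t * _; rewrite expRN; have := expR_gt0 E; move: (expR E) => e e0.
by field; rewrite gt_eqF.
Qed.

(** The majorant does not involve [c], so it serves along the whole limit. *)
Lemma recentered_density_le c x : 0 <= recentered_density c x <=
  expR (- (\sum_(i < N) x 0 i ^+ 2) / (2 * t)).
Proof.
have p01 (i j : 'I_N) :
    0 <= powR (tilt ((x 0 i - x 0 j) / (z 0 i - z 0 j) / c)) (c ^+ 2 / t) <= 1.
  rewrite powR_ge0/=; apply: (@le_trans _ _ (1 `^ (c ^+ 2 / t))).
    rewrite ge0_ler_powR ?nnegrE ?tilt_ge0//; last exact: tilt_le1.
    by rewrite divr_ge0 ?sqr_ge0 ?ltW.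
  by rewrite powR1.
rewrite mulr_ge0 ?expR_ge0//=; last first.
  by apply: prodr_ge0 => i _; apply: prodr_ge0 => j _; case/andP: (p01 i j).
rewrite ler_piMr ?expR_ge0//; apply: prodr_ile1 => i _.
rewrite prodr_ge0/=; last by move=> j _; case/andP: (p01 i j).
by apply: prodr_ile1 => j _; exact: p01.
Qed.

Lemma gauss_exp_continuous : coord_seq_continuous
  (fun x : 'rV[R]_N => expR (- (\sum_(i < N) x 0 i ^+ 2) / (2 * t))).
Proof.
move=> y x yx; apply: continuous_cvg; first exact: continuous_expR.
apply: cvgMr_tmp; apply: cvgN; apply: cvg_bigsum => i _.
apply: (@continuous_cvg _ _ _ _ _ _ (fun a : R => a ^+ 2)); last exact: yx.
exact: exprn_continuous.
Qed.

Lemma recentered_density_continuous c : 0 < c ->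
  coord_seq_continuous (recentered_density c).
Proof.
move=> c0 y x yx; apply: cvgM; first exact: gauss_exp_continuous.
apply: cvg_bigprod => i _; apply: cvg_bigprod => j _.
apply: (@continuous_cvg _ _ _ _ _ _ (fun w => powR (tilt w) (c ^+ 2 / t))).
  (* Positivity of the exponent is what keeps the power continuous where [tilt] vanishes. *)
  by apply: continuous_powR_tilt; rewrite divr_gt0// exprn_gt0.
by do 2 apply: cvgMr_tmp; apply: cvgB; exact: yx.
Qed.

Lemma recentered_density_cvg (c : nat -> R) x : c m @[m --> \oo] --> +oo ->
  recentered_density (c m) x @[m --> \oo] -->
  gauss_density (t *: invmx (Smat z)) x.
Proof.
move=> coo; rewrite gauss_density_form//; apply: cvgM; first exact: cvg_cst.
apply: cvg_bigprod => i _.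
apply: cvg_bigprod => j _.
exact: powR_tilt_cvg.
Qed.

Lemma gauss_density_le x : 0 <= gauss_density (t *: invmx (Smat z)) x <=
  expR (- (\sum_(i < N) x 0 i ^+ 2) / (2 * t)).
Proof.
rewrite expR_ge0/= gauss_density_form// ler_piMr ?expR_ge0//.
apply: prodr_ile1 => i _; rewrite prodr_ge0/=; last by move=> j _; exact: expR_ge0.
apply: prodr_ile1 => j _; rewrite expR_ge0/=; exact: gauss1_le1.
Qed.

Lemma gauss_density_continuous :
  coord_seq_continuous (gauss_density (t *: invmx (Smat z))).
Proof.
move=> y x yx; rewrite gauss_density_form//.
under eq_fun do rewrite gauss_density_form//.
apply: cvgM; first exact: gauss_exp_continuous.
apply: cvg_bigprod => i _; apply: cvg_bigprod => j _.
apply: continuous_cvg; first exact: continuous_expR.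
apply: cvgMr_tmp; apply: cvgN.
apply: (@continuous_cvg _ _ _ _ _ _ (fun a : R => a ^+ 2)).
  exact: exprn_continuous.
by apply: cvgMr_tmp; apply: cvgB; exact: yx.
Qed.

Let g0 : forall x, 0 <= gauss1 t x := gauss1_ge0 t.
Let g1 x : gauss1 t x <= 1. Proof. exact: gauss1_le1. Qed.
Let ig := gauss1_integrable t0.

Section test_function.
Variables (f : 'rV[R]_N -> R) (M : R).
Hypothesis cf : continuous f.
Hypothesis fM : forall x, `|f x| <= M.

Let M0 : 0 <= M. Proof. exact: le_trans (normr_ge0 _) (fM 0). Qed.

Lemma dominated_weighted (h : 'rV[R]_N -> R) :
  (forall x, 0 <= h x <= expR (- (\sum_(i < N) x 0 i ^+ 2) / (2 * t))) ->
  dominated (gauss1 t) M N (fun v => f (\row_(i < N) v i) * h (\row_(i < N) v i)).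
Proof.
move=> hh; apply: (@dominated_row _ _ _ _ (fun x => f x * h x)) => x.
have /andP[h0 hle] := hh x.
by rewrite normrM (ger0_norm h0) ler_pM.
Qed.

Lemma seq_continuous_weighted (h : 'rV[R]_N -> R) :
  coord_seq_continuous h ->
  seq_continuous N (fun v => f (\row_(i < N) v i) * h (\row_(i < N) v i)).
Proof.
move=> ch; apply: (@seq_continuous_row _ _ (fun x => f x * h x)) => y x yx.
by apply: cvgM; [exact: continuous_coord_seq|exact: ch].
Qed.

Lemma lebint_recentered_cvg (c : nat -> R) :
  (forall m, 0 < c m) -> c m @[m --> \oo] --> +oo ->
  lebint (fun x => f x * recentered_density (c m) x) @[m --> \oo] -->
  lebint (fun x => f x * gauss_density (t *: invmx (Smat z)) x).
Proof.
move=> c0 coo; apply: (iint_cvg g0 g1 ig M0).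
- by move=> m; apply: seq_continuous_weighted; exact: recentered_density_continuous.
- by apply: seq_continuous_weighted; exact: gauss_density_continuous.
- by move=> m; apply: dominated_weighted; exact: recentered_density_le.
- by apply: dominated_weighted; exact: gauss_density_le.
- by move=> v; apply: cvgM; [exact: cvg_cst|exact: recentered_density_cvg].
Qed.

(** This is the change of variables y = x + c z: the integrand on the left is [A * F] evaluated at y
    - c z. *)
Lemma lebint_bessel k A : 0 < k ->
  (forall x, bessel_density k t (x + Num.sqrt (2 * k * t) *: z) =
    A * recentered_density (Num.sqrt (2 * k * t)) x) ->
  lebint (fun y => f (y - Num.sqrt (2 * k * t) *: z) * bessel_density k t y) =
  A * lebint (fun x => f x * recentered_density (Num.sqrt (2 * k * t)) x).
Proof.
move=> k0; set c := Num.sqrt _ => AE.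
have c0 : 0 < c by rewrite sqrtr_gt0 !mulr_gt0.
have [s zs] := row_of_seq z.
pose F v := f (\row_(i < N) v i) * recentered_density c (\row_(i < N) v i).
have cF : seq_continuous N F.
  by apply: seq_continuous_weighted; exact: recentered_density_continuous.
have dF : dominated (gauss1 t) M N F.
  by apply: dominated_weighted; exact: recentered_density_le.
rewrite /lebint -(iintZ g0 g1 ig _ M0 cF dF).
transitivity (iint N (fun v => A * F (fun i => v i - c * s i))).
  congr iint; apply/funext => v; rewrite /F.
  have -> : \row_(i < N) (v i - c * s i) = \row_(i < N) v i - c *: z.
    by apply/rowP => i; rewrite [in RHS]zs !mxE.
  by rewrite mulrCA -AE subrK.
apply: (@iint_shift _ _ g0 g1 ig _ (fun v => A * F v) (`|A| * M)
  (fun i => c * s i)).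
- by rewrite mulr_ge0.
- by move=> u v uv; apply: cvgM; [exact: cvg_cst|exact: cF].
- by move=> v; rewrite normrM -mulrA ler_wpM2l.
- by move=> u v uv; congr (_ * (f _ * recentered_density c _));
    apply/rowP => i; rewrite !mxE uv.
Qed.

End test_function.

Lemma lebint_gauss_density_gt0 : 0 < lebint (gauss_density (t *: invmx (Smat z))).
Proof.
apply: (@iint_gt0 _ _ g0 g1 ig _ _ 1) => //.
- by apply: seq_continuous_row; exact: gauss_density_continuous.
- apply: dominated_row => x; have /andP[h0 hle] := gauss_density_le x.
  by rewrite ger0_norm// mul1r.
- by move=> v; exact: expR_gt0.
Qed.

(** The normalising integral is the case [f = 1], so the constant [A] cancels. The factor [1] is
    kept in the denominator so that one convergence lemma serves for both integrals. *)
Lemma bessel_expect_recenter k (f : 'rV[R]_N -> R) (M : R) : 0 < k ->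
  continuous f -> (forall x, `|f x| <= M) ->
  bessel_expect k t (fun y => f (y - Num.sqrt (2 * k * t) *: z)) =
  lebint (fun x => f x * recentered_density (Num.sqrt (2 * k * t)) x) /
  lebint (fun x => 1 * recentered_density (Num.sqrt (2 * k * t)) x).
Proof.
move=> k0 cf fM; have [A A0 AE] := bessel_density_recenter k0.
rewrite /bessel_expect (lebint_bessel cf fM k0 AE).
have -> : lebint (@bessel_density R N k t) =
    A * lebint (fun x => 1 * recentered_density (Num.sqrt (2 * k * t)) x).
  rewrite -(@lebint_bessel (cst 1) 1 _ _ k A k0 AE).
  - by congr lebint; apply/funext => y; rewrite mul1r.
  - exact: cst_continuous.
  - by move=> x; rewrite normr1.
by rewrite invfM mulrACA divff// mul1r.
Qed.

Lemma bessel_expect_cvg (f : 'rV[R]_N -> R) (M : R) :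
  continuous f -> (forall x, `|f x| <= M) ->
  (fun k : R => bessel_expect k t (fun y => f (y - Num.sqrt (2 * k * t) *: z)))
    @ +oo --> gauss_expect (t *: invmx (Smat z)) f.
Proof.
(* The limit over real [k] is tested on sequences tending to infinity, as dominated convergence
   requires. *)
move=> cf fM; apply/cvg_pinftyP => u uoo.
have [n _ un] : \forall m \near \oo, 1 <= u m by move/cvgryPge: uoo; exact.
(* Dropping the first [n] terms makes every multiplicity positive, as the formulas for the
   recentered density demand. *)
rewrite -(cvg_shiftn n)/=.
pose k m := u (m + n)%N; pose c m := Num.sqrt (2 * k m * t).
have k0 m : 0 < k m by apply: (lt_le_trans ltr01); apply: un => /=; exact: leq_addl.
have c0 m : 0 < c m by rewrite sqrtr_gt0 !mulr_gt0.
have koo : k m @[m --> \oo] --> +oo by move: uoo; rewrite -(cvg_shiftn n).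
have coo : c m @[m --> \oo] --> +oo.
  apply/cvgryPge => B; near=> m.
  (* The threshold is obtained by solving [B <= Num.sqrt (2 * k m * t)] for [k m]. *)
  have : B ^+ 2 / (2 * t) <= k m by near: m; move/cvgryPge: koo; exact.
  rewrite ler_pdivrMr ?mulr_gt0// => Bk.
  rewrite (le_trans (ler_norm B))// -sqrtr_sqr ler_sqrt.
    by rewrite (le_trans Bk)// le_eqVlt; apply/orP; left; apply/eqP; ring.
  by rewrite !mulr_ge0// ltW.
under eq_fun => m do rewrite (bessel_expect_recenter (k0 m) cf fM).
apply: cvgM; first exact: (lebint_recentered_cvg cf fM c0 coo).
(* The limit of the denominators is a positive Gaussian mass, so inversion is continuous there. *)
apply: cvgV; first by rewrite gt_eqF// lebint_gauss_density_gt0.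
have -> : gauss_density (t *: invmx (Smat z)) =
    fun x => cst 1 x * gauss_density (t *: invmx (Smat z)) x.
  by apply/funext => x; rewrite mul1r.
apply: (@lebint_recentered_cvg (cst 1) 1) => //.
- exact: cst_continuous.
- by move=> x; rewrite normr1.
Unshelve. all: end_near. Qed.

End limit_theorem.

Theorem theorem2p2 (R : realType) (N : nat) (hN : (0 < N)%N) (z : 'rV[R]_N) :
  (forall i j : 'I_N, (i < j)%N -> z 0 j < z 0 i) ->
  (forall i : 'I_N, root (hermite R N) (z 0 i)) ->
  Smat z \in unitmx /\
  forall t : R, 0 < t ->
  forall f : 'rV[R]_N -> R, continuous f -> (exists M : R, forall x, `|f x| <= M) ->
    (fun k : R => bessel_expect k t (fun y => f (y - Num.sqrt (2 * k * t) *: z)))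
      @ +oo --> gauss_expect (t *: invmx (Smat z)) f.
Proof.
move=> zdecr zroot; split; first exact: Smat_unit.
by move=> t t0 f cf [M fM]; exact (bessel_expect_cvg zdecr zroot t0 cf fM).
Qed.
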